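(* Let $K:\mathcal X\to\mathcal Y$ be a compact linear operator, let $\{\alpha_n\}_{n\in\mathbb N},\{r_n\}_{n\in\mathbb N}$ be sequences of positive real numbers, let $y$ be attainable and $x^\dagger=K^\dagger y$. Let $\{x_{\alpha_n,r_n}^n\}_{n\in\mathbb N}$ be a convergent sequence of the nonstationary iterated weighted Tikhonov (NSIWT) method (converging to $x^\dagger$), with $x^\dagger\in\mathcal X_\nu$ for some $\nu>0$, and let $\{\vartheta_n\}_{n\in\mathbb N}$ be a divergent sequence of positive real numbers. If $$\lim_{n\to\infty}\vartheta_n\sigma^\nu\prod_{k=1}^n\Big(1-\frac{\sigma^{r_k+1}}{\sigma^{r_k+1}+\alpha_k}\Big)=0\qquad\text{for every }\sigma\in\sigma(K)\setminus\{0\}$$ and $$\sup_{\sigma\in\sigma(K)\setminus\{0\}}\vartheta_n\sigma^\nu\prod_{k=1}^n\Big(1-\frac{\sigma^{r_k+1}}{\sigma^{r_k+1}+\alpha_k}\Big)\le c<\infty\qquad\text{uniformly with respect to }n,$$ then $$\|x^\dagger-x_{\alpha_n,r_n}^n\|=o(\vartheta_n^{-1}).$$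
   Context: $\mathcal X,\mathcal Y$ are Hilbert spaces; $y$ attainable means $y\in R(K)$; $K^\dagger$ is the Moore-Penrose generalized inverse. $(\sigma_m;v_m,u_m)$ is the singular value expansion of $K$ ($Kv_m=\sigma_mu_m$, $K^*u_m=\sigma_mv_m$, $\sigma_m>0$ decreasing); $\sigma(K)$ denotes the closure of $\{\sigma_m\}$. $\mathcal X_\nu=\{x\in\mathcal X:\ x=(K^*K)^{\nu/2}\omega\text{ for some }\omega\in\mathcal X\}$. NSIWT: $x_{\alpha_0,r_0}^0=0$ and, for $n\ge1$, $$\big[(K^*K)^{\frac{r_n+1}2}+\alpha_nI\big]x_{\alpha_n,r_n}^n=(K^*K)^{\frac{r_n-1}2}K^*y+\alpha_nx_{\alpha_{n-1},r_{n-1}}^{n-1},$$ where $(K^*K)^{\frac{r-1}2}K^*y:=\sum_m\sigma_m^{r}\langle y,u_m\rangle v_m$. *)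

(* Defs.v *)
From HB Require Import structures.
From mathcomp Require Import all_boot all_order all_algebra.
From mathcomp Require Import complex.
From mathcomp Require Import all_classical all_reals all_analysis.

Set Implicit Arguments.
Unset Strict Implicit.
Unset Printing Implicit Defensive.
Import Order.TTheory GRing.Theory Num.Theory.
Import numFieldNormedType.Exports.
Local Open Scope classical_set_scope.
Local Open Scope ring_scope.

(* Hilbert spaces are over either scalar field; inner products are linear in
   the first argument and conjugate-linear in the second. *)
Variant scalar_kind := RealScalars | ComplexScalars.

Definition scalar_field (k : scalar_kind) (R : realType) : numFieldType :=
  match k with RealScalars => R | ComplexScalars => R[i] end.

Definition scalar_conj (k : scalar_kind) (R : realType) :
    scalar_field k R -> scalar_field k R :=
  match k with
  | RealScalars => fun z : R => z
  | ComplexScalars => fun z : R[i] => Num.conj z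
  end.

(* In a normed module over R[i] the norm takes its values in R[i], as
   nonnegative reals; real data are embedded there to be compared with it. *)
Definition of_real (k : scalar_kind) (R : realType) : R -> scalar_field k R :=
  match k with
  | RealScalars => fun t : R => t
  | ComplexScalars => fun t : R => (t%:C)%C
  end.
Arguments of_real {k R}.

HB.mixin Record CompleteNormedModule_isHilbert (F : numFieldType)
    (theta : F -> F) X of CompleteNormedModule F X := {
  inner : {dot X for theta};
  sqr_norm_inner : forall x : X, `|x| ^+ 2 = inner x x }.

#[short(type="hilbertType")]
HB.structure Definition Hilbert (F : numFieldType) (theta : F -> F) :=
  {X of CompleteNormedModule F X & CompleteNormedModule_isHilbert F theta X}.

Section operators.
Context {k : scalar_kind} {R : realType}.
Context {X Y : hilbertType (@scalar_conj k R)}.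
Implicit Types (K : X -> Y) (x : X) (y : Y).

Definition compact_operator K :=
  forall A : set X, bounded_set A -> precompact (K @` A).

Definition is_adjoint K (Kst : Y -> X) :=
  forall x y, inner (K x) y = inner x (Kst y).

Definition orthocompl (H : hilbertType (@scalar_conj k R)) (A : set H) :
    set H :=
  [set h | forall a, A a -> inner h a = 0].

(* Graph of the Moore-Penrose inverse: the inverse of the restriction of K to
   N(K)^perp, extended by 0 on R(K)^perp. It is single-valued, with domain
   R(K) + R(K)^perp. *)
Definition moore_penrose K y x :=
  orthocompl [set z | K z = 0] x /\
  exists2 y' : Y, orthocompl (range K) y' & y = K x + y'.

(* The index set I is an initial segment of nat, finite when K has finite
   rank; the values of s, v, u outside I are irrelevant. *)
Record singular_system K (Kst : Y -> X) (I : pred nat)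
    (s : nat -> R) (v : nat -> X) (u : nat -> Y) : Prop := {
  sv_index_initial : forall m n, (m <= n)%N -> I n -> I m;
  sv_gt0 : forall m, I m -> 0 < s m;
  sv_nonincreasing : forall m n, (m <= n)%N -> I n -> s n <= s m;
  sv_orthonormal_v : forall m n, I m -> I n -> inner (v m) (v n) = (m == n)%:R;
  sv_orthonormal_u : forall m n, I m -> I n -> inner (u m) (u n) = (m == n)%:R;
  sv_K : forall m, I m -> K (v m) = of_real (s m) *: u m;
  sv_Kst : forall m, I m -> Kst (u m) = of_real (s m) *: v m;
  sv_expansion : forall x,
    (fun n => \sum_(0 <= m < n | I m)
       (of_real (s m) * inner x (v m)) *: u m) @ \oo --> K x }.

End operators.

(* sigma(K) *)
Definition sv_spectrum (R : realType) (I : pred nat) (s : nat -> R) : set R :=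
  closure [set s m | m in [set m | I m]].

Section singular_calculus.
Context {k : scalar_kind} {R : realType}.
Context {X Y : hilbertType (@scalar_conj k R)}.
Variables (I : pred nat) (s : nat -> R) (v : nat -> X) (u : nat -> Y).

Definition sv_series (f : nat -> X) : X :=
  limn (fun n => \sum_(0 <= m < n | I m) f m).

(* (K^* K)^p for p > 0; the eigenvalues of K^* K are the s m ^+ 2. *)
Definition gram_pow (p : R) (x : X) : X :=
  sv_series (fun m => (of_real ((s m ^+ 2) `^ p) * inner x (v m)) *: v m).

(* (K^* K)^((r - 1) / 2) K^* *)
Definition weighted_adjoint (r : R) (y : Y) : X :=
  sv_series (fun m => (of_real (s m `^ r) * inner y (u m)) *: v m).

(* X_nu = R((K^* K)^(nu / 2)) *)
Definition source_space (nu : R) : set X := range (gram_pow (nu / 2)).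

(* The entries alpha 0 and r 0 play no role. *)
Definition NSIWT (alpha r : nat -> R) (y : Y) (x : nat -> X) :=
  x 0%N = 0 /\
  forall n, (0 < n)%N ->
    gram_pow ((r n + 1) / 2) (x n) + of_real (alpha n) *: x n =
    weighted_adjoint (r n) y + of_real (alpha n) *: x n.-1.

End singular_calculus.

(* Main.v *)
Require Import Defs.
From HB Require Import structures.
From mathcomp Require Import all_boot all_order all_algebra.
From mathcomp Require Import complex.
From mathcomp Require Import all_classical all_reals all_analysis.
From mathcomp Require Import lra.

Set Implicit Arguments.
Unset Strict Implicit.
Unset Printing Implicit Defensive.
Import Order.TTheory GRing.Theory Num.Theory.
Import numFieldNormedType.Exports.
Local Open Scope classical_set_scope.
Local Open Scope ring_scope.

(** In the basis of right singular vectors the method is diagonal. Testing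
    one step against [v m] gives a scalar recurrence whose solution
    ([inner_error]) says that the [m]-th coefficient of [xdag - x n] is that of
    [xdag] times the product of the
    [1 - s m `^ (r j + 1) / (s m `^ (r j + 1) + alpha j)] for [1 <= j <= n].
    The source condition [xdag = (K^* K)^(nu / 2) w] contributes the factor
    [s m `^ nu], so the coefficient of [theta n *: (xdag - x n)] is
    [g n m * inner w (v m)], where [g n m] is the expression that the two
    spectral hypotheses control, at [sigma = s m]. By Parseval, the squared norm of
    [theta n *: (xdag - x n)] is the sum over [m] of
    [g n m ^+ 2 * `|inner w (v m)| ^+ 2]; the [g n m] are bounded by [c], tend
    to [0] for each [m], and [\sum_m `|inner w (v m)| ^+ 2] is finite by
    Bessel's inequality, so dominated convergence for series ([tannery])
    makes the sum tend to [0].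

    Two points need care. The operators are limits of series, so their
    coefficients are known only once the series converge: Bessel's inequality
    and completeness give this ([dominated_sv_series]). Parseval's identity
    requires [xdag - x n] to lie in the closed span of the [v m]: [xdag] does
    as a value of [(K^* K)^(nu / 2)], and the iterates do by induction
    ([iterate_expandable]).

    The scalars are either [R] or [R[i]], and norms are scalars. The case
    distinction is confined to a few facts on [of_real] and [scalar_conj];
    after these, only the existence of suprema ([sum_tail_small]) goes back to
    real numbers, which is possible because nonnegative scalars are real. *)

(** * Real and complex scalars *)

Section scalars.
Context {k : scalar_kind} {R : realType}.
Local Notation F := (scalar_field k R).
Implicit Types (a b : R) (z : F).

Lemma of_realD a b : of_real (a + b) = of_real a + of_real b :> F.
Proof. by case: k => //=; rewrite rmorphD. Qed.

Lemma of_realB a b : of_real (a - b) = of_real a - of_real b :> F.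
Proof. by case: k => //=; rewrite rmorphB. Qed.

Lemma of_realM a b : of_real (a * b) = of_real a * of_real b :> F.
Proof. by case: k => //=; rewrite rmorphM. Qed.

Lemma of_real0 : of_real 0 = 0 :> F.
Proof. by case: k. Qed.

Lemma of_real1 : of_real 1 = 1 :> F.
Proof. by case: k. Qed.

Lemma of_realV a : of_real a^-1 = (of_real a)^-1 :> F.
Proof. by case: k => //=; rewrite fmorphV. Qed.

Lemma of_real_le a b : (of_real a <= of_real b :> F) = (a <= b).
Proof. by case: k => //=; rewrite lecR. Qed.

Lemma of_real_lt a b : (of_real a < of_real b :> F) = (a < b).
Proof. by case: k => //=; rewrite ltcR. Qed.

Lemma of_real_ge0 a : (0 <= of_real a :> F) = (0 <= a).
Proof. by rewrite -of_real0 of_real_le. Qed.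

Lemma of_real_gt0 a : (0 < of_real a :> F) = (0 < a).
Proof. by rewrite -of_real0 of_real_lt. Qed.

Lemma of_real_norm a : `|of_real a : F| = of_real `|a|.
Proof. by case: k => //=; rewrite normc_def /= expr0n addr0 sqrtr_sqr. Qed.

Lemma of_real_surj_ge0 z : 0 <= z -> exists2 a : R, 0 <= a & z = of_real a.
Proof.
case: k z => [z z0|[a b]]; first by exists z.
by rewrite lecE /= => /andP[/eqP -> a0]; exists a.
Qed.

Lemma mul_scalar_conj z : z * scalar_conj z = `|z| ^+ 2.
Proof.
by case: k z => z /=; [rewrite real_normK ?num_real ?expr2|rewrite normCK].
Qed.

Lemma scalar_conj_ge0 z : 0 <= z -> scalar_conj z = z.
Proof. by case: k z => z //= z0; rewrite geC0_conj. Qed.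

End scalars.

(** * Series of nonnegative scalars *)

Section series_of_scalars.
Context {k : scalar_kind} {R : realType}.
Local Notation F := (scalar_field k R).

(** Convergence of a bounded series with nonnegative terms, in the Cauchy form
    that makes sense in [R[i]], where the order is partial: the partial sums
    are real, and one of them comes within [d] of their supremum. *)
Lemma sum_tail_small (P : pred nat) (a : nat -> F) (B : F) :
  (forall m, P m -> 0 <= a m) ->
  (forall n, \sum_(0 <= m < n | P m) a m <= B) ->
  forall d : F, 0 < d ->
    exists N, forall n, \sum_(N <= m < n | P m) a m <= d.
Proof.
move=> a0 aB d d0.
have [d' d'0 dE] := of_real_surj_ge0 (ltW d0).
have B0 : 0 <= B by apply: le_trans (aB 0%N); rewrite big_geq.
have [B' _ BE] := of_real_surj_ge0 B0.
pose S n := \sum_(0 <= m < n | P m) a m.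
pose E := [set t : R | exists n, S n = of_real t].
have S0 n : 0 <= S n by apply: sumr_ge0.
have supE : has_sup E.
  split; first by exists 0, 0%N; rewrite /S big_geq // of_real0.
  exists B' => t [n Sn]; rewrite -(@of_real_le k) -Sn -BE; exact: aB.
have d'_gt0 : 0 < d' by rewrite -(@of_real_gt0 k) -dE.
have [e [N SN] eN] := sup_adherent d'_gt0 supE.
exists N => n; have [nN|Nn] := leqP n N; first by rewrite big_geq // ltW.
have [t t0 Sn] := of_real_surj_ge0 (S0 n).
have -> : \sum_(N <= m < n | P m) a m = S n - S N.
  rewrite /S (big_cat_nat (m := 0%N) (n := N)) //= 1?ltnW //.
  by rewrite [RHS]addrC addKr.
rewrite Sn SN dE -of_realB of_real_le.
have tE : t <= sup E by apply: ub_le_sup; [case: supE|exists n].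
lra.
Qed.

(** Dominated convergence for series. Beyond some [M] the tail of [\sum a] is
    so small that the bound [C] on the weights suffices; the finitely many
    weights before [M] are eventually uniformly small. *)
Lemma tannery (P : pred nat) (a : nat -> F) (B C : F) (G : nat -> nat -> F) :
  (forall m, P m -> 0 <= a m) ->
  (forall n, \sum_(0 <= m < n | P m) a m <= B) ->
  0 <= C -> (forall n m, P m -> 0 <= G n m <= C) ->
  (forall m, P m -> forall t, 0 < t -> \forall n \near \oo, G n m <= t) ->
  forall d, 0 < d ->
    \forall n \near \oo, forall N, \sum_(0 <= m < N | P m) G n m * a m <= d.
Proof.
move=> a0 aB C0 GC Glim d d0.
have B0 : 0 <= B by apply: le_trans (aB 0%N); rewrite big_geq.
have d20 : 0 < d / 2 by rewrite divr_gt0.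
have C1 : 0 < C + 1 by rewrite ltr_wpDl.
have B1 : 0 < B + 1 by rewrite ltr_wpDl.
have [M tailM] := sum_tail_small a0 aB (divr_gt0 d20 C1).
have headM : \forall n \near \oo, forall m, (m < M)%N -> P m ->
    G n m <= d / 2 / (B + 1).
  have : \forall n \near \oo, forall i : 'I_M, P i ->
      G n i <= d / 2 / (B + 1).
    apply: filter_forall => i.
    have [Pi|nPi] := boolP (P i); last by apply: nearW => n.
    by apply: filterS (Glim i Pi _ (divr_gt0 d20 B1)) => n.
  by apply: filterS => n Hn m mM; apply: (Hn (Ordinal mM)).
apply: filterS headM => n Hn N.
have pos m : P m -> 0 <= G n m * a m.
  by move=> Pm; rewrite mulr_ge0 ?a0 //; case/andP: (GC n m Pm).
(* Summing up to [M + N] makes sure that the cut at [M] is within the range. *)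
apply: (@le_trans _ _ (\sum_(0 <= m < M + N | P m) G n m * a m)).
  rewrite (big_cat_nat (n := N) (p := M + N)) ?leq_addl //=.
  by rewrite lerDl sumr_ge0.
rewrite (big_cat_nat (n := M)) ?leq_addr //= (splitr d) lerD //.
  apply: (@le_trans _ _ (\sum_(0 <= m < M | P m) (d / 2 / (B + 1)) * a m)).
    rewrite big_nat_cond [leRHS]big_nat_cond; apply: ler_sum => m.
    by case/andP=> /andP[_ mM] Pm; rewrite ler_wpM2r ?a0 ?Hn.
  rewrite -mulr_sumr mulrAC ler_pdivrMr // ler_wpM2l ?ltW //.
  by apply: le_lt_trans (aB M) _; rewrite ltrDl.
apply: (@le_trans _ _ (\sum_(M <= m < M + N | P m) C * a m)).
  by apply: ler_sum => m Pm; rewrite ler_wpM2r ?a0 //; case/andP: (GC n m Pm).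
rewrite -mulr_sumr; apply: le_trans (ler_wpM2l C0 (tailM _)) _.
by rewrite mulrA ler_pdivrMr // mulrC ler_wpM2l ?lerDl // ltW.
Qed.

End series_of_scalars.

(** * Orthonormal families in a Hilbert space *)

Section hilbert.
Context {k : scalar_kind} {R : realType}.
Context {X : hilbertType (@scalar_conj k R)}.
Local Notation F := (scalar_field k R).
Implicit Types (x y : X) (a : F).

Lemma innerC x y : inner x y = scalar_conj (inner y x).
Proof. by rewrite (hermitian_subproof (s := inner)) expr0 mul1r. Qed.

Lemma innerDl x y z : inner (x + y) z = inner x z + inner y z.
Proof. exact: linearDl. Qed.

Lemma innerBl x y z : inner (x - y) z = inner x z - inner y z.
Proof. exact: linearBl. Qed.

Lemma innerBr x y z : inner x (y - z) = inner x y - inner x z.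
Proof. exact: linearBr. Qed.

Lemma innerZl a x y : inner (a *: x) y = a * inner x y.
Proof. exact: linearZl_LR. Qed.

Lemma innerZr a x y : inner x (a *: y) = scalar_conj a * inner x y.
Proof. exact: linearZr_LR. Qed.

Lemma inner0l x : inner 0 x = 0.
Proof. exact: linear0l. Qed.

Lemma inner_suml (r : seq nat) (P : pred nat) (f : nat -> X) y :
  inner (\sum_(i <- r | P i) f i) y = \sum_(i <- r | P i) inner (f i) y.
Proof. exact: linear_sumlz. Qed.

Lemma inner_sumr (r : seq nat) (P : pred nat) (f : nat -> X) y :
  inner y (\sum_(i <- r | P i) f i) = \sum_(i <- r | P i) inner y (f i).
Proof. exact: linear_sumr. Qed.

Variables (I : pred nat) (v : nat -> X).
Hypothesis onv : forall m n, I m -> I n -> inner (v m) (v n) = (m == n)%:R.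
Implicit Types c : nat -> F.

Lemma inner_partial_sum c p q j : I j ->
  inner (\sum_(p <= m < q | I m) c m *: v m) (v j) =
  if (p <= j < q)%N then c j else 0.
Proof.
move=> Ij; rewrite inner_suml.
under eq_bigr => m Im do rewrite innerZl onv // mulr_natr mulrb.
case: ifPn => pjq.
  rewrite big_mkcond (bigD1_seq j) ?mem_index_iota ?iota_uniq //= Ij eqxx.
  by rewrite big1 ?addr0 // => m /negbTE ->; rewrite if_same.
rewrite big_nat_cond big1 // => m /andP[pmq _].
by case: eqP => // mj; rewrite -mj pmq in pjq.
Qed.

Lemma norm2_partial_sum c p q :
  `|\sum_(p <= m < q | I m) c m *: v m| ^+ 2 =
  \sum_(p <= m < q | I m) `|c m| ^+ 2.
Proof.
rewrite sqr_norm_inner inner_sumr.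
rewrite big_nat_cond [RHS]big_nat_cond; apply: eq_bigr => j /andP[pjq Ij].
by rewrite innerZr inner_partial_sum // pjq mulrC mul_scalar_conj.
Qed.

(** The right-hand side minus the left-hand side is the squared distance from
    [x] to the partial sum of its expansion. *)
Lemma bessel x n :
  \sum_(0 <= m < n | I m) `|inner x (v m)| ^+ 2 <= `|x| ^+ 2.
Proof.
set S := \sum_(_ <= m < _ | _) _.
pose p := \sum_(0 <= m < n | I m) inner x (v m) *: v m.
have pp : inner p p = S by rewrite -sqr_norm_inner norm2_partial_sum.
have xp : inner x p = S.
  rewrite inner_sumr; apply: eq_bigr => m _.
  by rewrite innerZr mulrC mul_scalar_conj.
have px : inner p x = S.
  by rewrite innerC xp -pp -sqr_norm_inner scalar_conj_ge0 ?exprn_ge0.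
have : 0 <= `|x - p| ^+ 2 by rewrite exprn_ge0.
rewrite sqr_norm_inner innerBl !innerBr pp xp px subrr subr0.
by rewrite subr_ge0 -sqr_norm_inner.
Qed.

Lemma norm_inner_le x j : I j -> `|inner x (v j)| <= `|x|.
Proof.
move=> Ij; rewrite -(@ler_pXn2r _ 2) ?nnegrE //.
apply: le_trans (bessel x j.+1).
by rewrite big_mkcond big_nat_recr //= Ij lerDr sumr_ge0 // => m _; case: ifP.
Qed.

(** Coefficients are continuous, and the [j]-th coefficient of the partial sums
    is constantly [c j] beyond [j]. *)
Lemma inner_limit c x j : I j ->
  (fun n => \sum_(0 <= m < n | I m) c m *: v m) @ \oo --> x ->
  inner x (v j) = c j.
Proof.
move=> Ij cx; apply/eqP; rewrite -subr_eq0 -normr_le0.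
apply/ler_addgt0Pl => e e0; rewrite addr0.
have /cvgrPdist_lt/(_ e e0) [N _ HN] := cx.
have /HN /ltW : (N <= maxn N j.+1)%N by rewrite leq_maxl.
apply: le_trans; apply: le_trans (norm_inner_le _ Ij).
by rewrite innerBl inner_partial_sum //= leq_maxr.
Qed.

(** The coefficients of [x] are square summable by Bessel's inequality, hence
    so are the [c m]; the squared distance between two partial sums is a
    stretch of [\sum_m `|c m| ^+ 2], so the partial sums are Cauchy. *)
Lemma cvg_dominated_series c (B : F) x :
  0 <= B -> (forall m, I m -> `|c m| <= B * `|inner x (v m)|) ->
  cvg ((fun n => \sum_(0 <= m < n | I m) c m *: v m) @ \oo).
Proof.
move=> B0 cB; apply: cauchy_cvg; apply: cauchy_exP => e e0.
have e20 : 0 < e / 2 by rewrite divr_gt0.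
have [N HN] : exists N, forall n,
    \sum_(N <= m < n | I m) `|c m| ^+ 2 <= (e / 2) ^+ 2.
  apply: (@sum_tail_small _ _ _ _ (B ^+ 2 * `|x| ^+ 2)).
  - by move=> m _; rewrite exprn_ge0.
  - move=> n; apply: le_trans (ler_wpM2l _ (bessel x n)); rewrite ?exprn_ge0 //.
    rewrite mulr_sumr; apply: ler_sum => m Im.
    by rewrite -exprMn lerXn2r ?nnegrE ?mulr_ge0 ?cB.
  - by rewrite exprn_gt0.
exists (\sum_(0 <= m < N | I m) c m *: v m); exists N => // n /= Nn.
rewrite -ball_normE /= distrC (big_cat_nat (m := 0%N) (n := N)) //=.
rewrite [X in `|X|]addrAC subrr add0r.
apply: (@le_lt_trans _ _ (e / 2)); last by rewrite ltr_pdivrMr ?ltr_pMr ?ltr1n.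
by have := HN n; rewrite -norm2_partial_sum ler_pXn2r ?nnegrE // ltW.
Qed.

Definition expansion x (n : nat) :=
  \sum_(0 <= m < n | I m) inner x (v m) *: v m.

(** Membership in the closed span of the family, in the form in which it is
    used: it is visibly linear and gives Parseval's identity. *)
Definition expandable x := expansion x @ \oo --> x.

Lemma expandable0 : expandable 0.
Proof.
rewrite /expandable [X in X @ _](_ : _ = cst 0); first exact: cvg_cst.
apply/funext => n; rewrite /expansion big1 // => m _.
by rewrite inner0l scale0r.
Qed.

Lemma expandableD x y : expandable x -> expandable y -> expandable (x + y).
Proof.
move=> hx hy; rewrite /expandable.
rewrite [X in X @ _](_ : _ = expansion x \+ expansion y); first exact: cvgD.
apply/funext => n; rewrite /expansion /= -big_split /=; apply: eq_bigr => m _.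
by rewrite innerDl scalerDl.
Qed.

Lemma expandableZ a x : expandable x -> expandable (a *: x).
Proof.
move=> hx; rewrite /expandable.
rewrite [X in X @ _](_ : _ = a \*: expansion x); first exact: cvgZl_tmp.
apply/funext => n; rewrite /expansion /= scaler_sumr; apply: eq_bigr => m _.
by rewrite innerZl scalerA.
Qed.

Lemma expandableB x y : expandable x -> expandable y -> expandable (x - y).
Proof.
move=> hx hy; rewrite -scaleN1r.
by apply: expandableD => //; exact: expandableZ.
Qed.

(** All that the convergence theorem needs about the operators defined by
    series in the [v m]. The sum is expandable since its own expansion is the
    series that defines it. *)
Lemma dominated_sv_series c (B : F) x :
  0 <= B -> (forall m, I m -> `|c m| <= B * `|inner x (v m)|) ->
  let z := sv_series I (fun m => c m *: v m) in
  (forall j, I j -> inner z (v j) = c j) /\ expandable z.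
Proof.
move=> B0 cB z.
have cz : (fun n => \sum_(0 <= m < n | I m) c m *: v m) @ \oo --> z.
  exact: cvg_dominated_series cB.
have zc j : I j -> inner z (v j) = c j by move=> Ij; exact: inner_limit cz.
split=> //; rewrite /expandable /expansion.
by under eq_fun do [under eq_bigr => m Im do rewrite zc //].
Qed.

End hilbert.

(** * The iterated weighted Tikhonov method in the singular basis *)

Section method.
Context {k : scalar_kind} {R : realType}.
Local Notation F := (scalar_field k R).
Context {X Y : hilbertType (@scalar_conj k R)}.
Context {K : {linear X -> Y}} {Kst : Y -> X} {I : pred nat} {s : nat -> R}.
Context {v : nat -> X} {u : nat -> Y}.
Hypothesis hKst : is_adjoint K Kst.
Hypothesis hsv : singular_system K Kst I s v u.

Let onv : forall m n, I m -> I n -> inner (v m) (v n) = (m == n)%:R.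
Proof. exact: sv_orthonormal_v hsv. Qed.

Let s_gt0 m : I m -> 0 < s m.
Proof. exact: sv_gt0 hsv m. Qed.

Lemma sv_powR_le (p : R) m : 0 <= p -> I m -> s m `^ p <= s 0%N `^ p.
Proof.
move=> p0 Im; have I0 := sv_index_initial hsv (leq0n m) Im.
rewrite ge0_ler_powR ?nnegrE ?(ltW (s_gt0 _)) //.
exact: sv_nonincreasing hsv _ _ (leq0n m) Im.
Qed.

(** Common to [gram_pow] and [weighted_adjoint]: as the largest singular value
    is [s 0], the coefficients are dominated by [s 0 `^ p] times those of
    [x]. *)
Lemma power_series_spec (p : R) (x : X) (f : nat -> F) : 0 <= p ->
  (forall m, I m -> f m = of_real (s m `^ p) * inner x (v m)) ->
  let z := sv_series I (fun m => f m *: v m) in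
  (forall j, I j -> inner z (v j) = of_real (s j `^ p) * inner x (v j)) /\
  expandable I v z.
Proof.
move=> p0 fE z.
have B0 : 0 <= of_real (s 0%N `^ p) :> F.
  by rewrite of_real_ge0 powR_ge0.
have [|zv zE] := @dominated_sv_series _ _ _ _ _ onv f _ x B0.
  move=> m Im; rewrite fE // normrM of_real_norm (ger0_norm (powR_ge0 _ _)).
  by rewrite ler_wpM2r // of_real_le sv_powR_le.
by split=> // j Ij; rewrite zv // fE.
Qed.

Lemma sqr_powR m (p : R) : I m -> (s m ^+ 2) `^ (p / 2) = s m `^ p.
Proof.
by move=> Im; rewrite -powR_mulrn ?ltW ?s_gt0 // -powRrM mulrC divfK.
Qed.

Lemma gram_pow_spec (p : R) (x : X) : 0 <= p ->
  (forall j, I j -> inner (gram_pow I s v (p / 2) x) (v j)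
     = of_real (s j `^ p) * inner x (v j)) /\
  expandable I v (gram_pow I s v (p / 2) x).
Proof. by move=> p0; apply: power_series_spec => // m Im; rewrite sqr_powR. Qed.

Lemma inner_u (x : X) m : I m ->
  inner (K x) (u m) = of_real (s m) * inner x (v m).
Proof.
move=> Im; rewrite hKst (sv_Kst hsv) // innerZr scalar_conj_ge0 //.
by rewrite of_real_ge0 ltW ?s_gt0.
Qed.

(** On exact data the extra factor [s m] of [inner_u] turns [r] into [r + 1],
    the exponent of the operator on the left of the iteration. *)
Lemma weighted_adjoint_spec (r : R) (x : X) : 0 < r ->
  (forall j, I j -> inner (weighted_adjoint I s v u r (K x)) (v j)
     = of_real (s j `^ (r + 1)) * inner x (v j)) /\
  expandable I v (weighted_adjoint I s v u r (K x)).
Proof.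
move=> r0; apply: power_series_spec => [|m Im]; first by rewrite addr_ge0 ?ltW.
rewrite inner_u // mulrA -of_realM powRD ?powRr1 ?ltW ?s_gt0 //.
by rewrite gt_eqF ?addr_gt0.
Qed.

(** The component [y'] of [y] in the orthogonal complement of the range also
    lies in the range, so it is orthogonal to itself. *)
Lemma moore_penrose_range (y : Y) (x : X) :
  range K y -> moore_penrose K y x -> y = K x.
Proof.
move=> [z _ Kz] [_ [y' y'K yE]].
suff y'0 : y' = 0 by rewrite yE y'0 addr0.
apply/eqP; rewrite -normr_eq0 -sqrf_eq0 sqr_norm_inner; apply/eqP.
apply: y'K; exists (z - x) => //.
by rewrite linearB Kz yE addrAC subrr add0r.
Qed.

Variables (alpha r : nat -> R) (x : nat -> X) (xdag : X).
Hypothesis halpha : forall n, 0 < alpha n.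
Hypothesis hr : forall n, 0 < r n.
Hypothesis hx : NSIWT I s v u alpha r (K xdag) x.

Definition filter_factor (t : R) n :=
  \prod_(1 <= j < n.+1) (1 - t `^ (r j + 1) / (t `^ (r j + 1) + alpha j)).

Lemma filter_factor_ge0 t n : 0 <= filter_factor t n.
Proof.
apply: prodr_ge0 => j _; rewrite subr_ge0 ler_pdivrMr ?ltr_wpDl ?powR_ge0 //.
by rewrite mul1r lerDl ltW.
Qed.

(** Dividing one step of the iteration by [alpha n.+1] writes the new iterate
    as a linear combination of values of the operators and the old iterate. *)
Lemma iterate_expandable n : expandable I v (x n).
Proof.
have [x0 xS] := hx.
elim: n => [|n IH]; first by rewrite x0; exact: expandable0.
have := xS n.+1 isT => /= /eqP; rewrite addrC eq_sym -subr_eq => /eqP xE.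
have a0 : of_real (alpha n.+1) != 0 :> F.
  by rewrite lt0r_neq0 ?of_real_gt0.
rewrite -[x n.+1](scalerK a0); apply: expandableZ; rewrite -xE.
apply: expandableB; first apply: expandableD.
- exact: (weighted_adjoint_spec _ (hr _)).2.
- exact: expandableZ.
- by apply: (gram_pow_spec _ _).2; rewrite addr_ge0 ?ltW.
Qed.

(** With [t = s j `^ (r n.+1 + 1)], the [j]-th coefficient of a step reads
    [(t + alpha n.+1) * error (n.+1) = alpha n.+1 * error n], and the quotient
    of the two factors is [1 - t / (t + alpha n.+1)]. The initial error is
    [xdag], as the method starts at [0]. *)
Lemma inner_error n j : I j ->
  inner (xdag - x n) (v j) = of_real (filter_factor (s j) n) * inner xdag (v j).
Proof.
move=> Ij; have [x0 xS] := hx.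
elim: n => [|n IH].
  by rewrite x0 subr0 /filter_factor big_geq // of_real1 mul1r.
set t := s j `^ (r n.+1 + 1).
have xE : of_real t * inner (x n.+1) (v j)
      + of_real (alpha n.+1) * inner (x n.+1) (v j)
    = of_real t * inner xdag (v j) + of_real (alpha n.+1) * inner (x n) (v j).
  have := congr1 (fun z => inner z (v j)) (xS n.+1 isT).
  rewrite !innerDl !innerZl (weighted_adjoint_spec _ (hr _)).1 //.
  by rewrite (gram_pow_spec _ _).1 ?addr_ge0 ?ltW.
have ta : of_real (t + alpha n.+1) != 0 :> F.
  by rewrite lt0r_neq0 ?of_real_gt0 ?ltr_wpDl ?powR_ge0.
apply: (mulfI ta).
rewrite /filter_factor big_nat_recr //= -/(filter_factor _ _) -/t.
have -> : 1 - t / (t + alpha n.+1) = alpha n.+1 / (t + alpha n.+1).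
  have : t + alpha n.+1 != 0 by rewrite gt_eqF // ltr_wpDl ?powR_ge0.
  by move=> h; rewrite -[X in X - _](divff h) -mulrBl addrAC subrr add0r.
transitivity (of_real (alpha n.+1) * inner (xdag - x n) (v j)).
  rewrite !innerBl of_realD !mulrBr !mulrDl xE.
  by rewrite opprD addrACA subrr add0r.
rewrite IH !of_realM of_realV.
rewrite mulrA [RHS]mulrA; congr (_ * _).
by rewrite mulrC mulrCA [X in _ = _ * X]mulrC divfK.
Qed.


Lemma norm2_error_partial_sum (w : X) (nu : R) (N n : nat) :
  (forall m, I m -> inner xdag (v m) = of_real (s m `^ nu) * inner w (v m)) ->
  `|expansion I v (xdag - x n) N| ^+ 2 =
  \sum_(0 <= m < N | I m)
    of_real ((s m `^ nu * filter_factor (s m) n) ^+ 2) * `|inner w (v m)| ^+ 2.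
Proof.
move=> xw; rewrite norm2_partial_sum //; apply: eq_bigr => m Im.
rewrite inner_error // xw // mulrA -of_realM normrM exprMn of_real_norm.
rewrite (mulrC (filter_factor _ _)) [X in X * _]expr2 -of_realM -expr2.
by rewrite (@real_normK R) ?num_real.
Qed.

End method.

Theorem theorem26 (k : scalar_kind) (R : realType)
    (X Y : hilbertType (@scalar_conj k R))
    (K : {linear X -> Y}) (Kst : Y -> X)
    (I : pred nat) (s : nat -> R) (v : nat -> X) (u : nat -> Y)
    (alpha r theta : nat -> R) (nu c : R)
    (y : Y) (xdag : X) (x : nat -> X)
    (hK : compact_operator K)
    (hKst : is_adjoint K Kst)
    (hsv : singular_system K Kst I s v u)
    (halpha : forall n, 0 < alpha n)
    (hr : forall n, 0 < r n)
    (hy : range K y)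
    (hxdag : moore_penrose K y xdag)
    (hx : NSIWT I s v u alpha r y x)
    (hcvg : x n @[n --> \oo] --> xdag)
    (hnu : 0 < nu)
    (hsource : source_space I s v nu xdag)
    (htheta : forall n, 0 < theta n)
    (hdvg : ~ cvgn theta)
    (hlim : forall sigma : R, (sv_spectrum I s `\ 0) sigma ->
       theta n * sigma `^ nu *
         \prod_(1 <= j < n.+1)
           (1 - sigma `^ (r j + 1) / (sigma `^ (r j + 1) + alpha j))
         @[n --> \oo] --> (0 : R))
    (hsup : forall n : nat,
       (ereal_sup [set (theta n * sigma `^ nu *
          \prod_(1 <= j < n.+1)
            (1 - sigma `^ (r j + 1) / (sigma `^ (r j + 1) + alpha j)))%:E
          | sigma in sv_spectrum I s `\ 0%R] <= c%:E)%E) :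
  (fun n => `|xdag - x n| : scalar_field k R) =o_\oo
    (fun n => of_real (theta n)^-1 : scalar_field k R).
Proof.
have [w _ xdagE] := hsource.
have onv := sv_orthonormal_v hsv.
have s0 := sv_gt0 hsv.
have [xw xdag_exp] := gram_pow_spec hsv w (ltW hnu).
rewrite xdagE in xw xdag_exp.
have yE := moore_penrose_range hy hxdag.
have hx' : NSIWT I s v u alpha r (K xdag) x by rewrite -yE.
have spec_s m : I m -> (sv_spectrum I s `\ 0) (s m).
  move=> Im; split; first by apply: subset_closure; exists m.
  by move=> /= sm0; have := s0 m Im; rewrite sm0 ltxx.
pose g n m := theta n * s m `^ nu * filter_factor alpha r (s m) n.
have g_ge0 n m : 0 <= g n m.
  by rewrite !mulr_ge0 ?powR_ge0 ?filter_factor_ge0 // ltW.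
have g_le n m : I m -> g n m <= c.
  move=> Im; rewrite -lee_fin; apply: le_trans (hsup n).
  by apply: ereal_sup_ubound; exists (s m); first exact: spec_s.
have g_lim m : I m -> forall t : scalar_field k R, 0 < t ->
    \forall n \near \oo, of_real (g n m ^+ 2) <= t.
  move=> Im t t0; have [t' t'0 tE] := of_real_surj_ge0 (ltW t0).
  have st0 : 0 < Num.sqrt t' by rewrite sqrtr_gt0 -(@of_real_gt0 k) -tE.
  have /cvgrPdist_lt/(_ _ st0) := hlim _ (spec_s _ Im).
  apply: filterS => n; rewrite sub0r normrN -/(g n m) => gt.
  rewrite tE of_real_le -(sqr_sqrtr t'0).
  rewrite ler_pXn2r ?nnegrE ?sqrtr_ge0 // ltW //.
  by rewrite (le_lt_trans _ gt) ?ler_norm.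
apply/eqoP => eps eps0.
have e20 : 0 < eps / 2 by rewrite divr_gt0.
have := @tannery k R I (fun m => `|inner w (v m)| ^+ 2) (`|w| ^+ 2)
  (of_real (c ^+ 2)) (fun n m => of_real (g n m ^+ 2)).
move=> /(_ _ _ _ _ g_lim ((eps / 2) ^+ 2)) tan.
have {tan} : \forall n \near \oo, forall N,
    \sum_(0 <= m < N | I m) of_real (g n m ^+ 2) * `|inner w (v m)| ^+ 2
      <= (eps / 2) ^+ 2.
  apply: tan; last by rewrite exprn_gt0.
  - by move=> m _; rewrite exprn_ge0.
  - exact: bessel.
  - by rewrite of_real_ge0 sqr_ge0.
  - move=> n m Im; rewrite of_real_ge0 sqr_ge0 of_real_le.
    by rewrite ler_pXn2r ?nnegrE ?g_le // (le_trans (g_ge0 n m)) ?g_le.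
apply: filterS => n Hn.
have th0 : 0 < of_real (theta n) :> scalar_field k R by rewrite of_real_gt0.
have exp_n : expandable I v (xdag - x n).
  apply: expandableB => //.
  exact: (iterate_expandable hKst hsv halpha hr hx').
(* Half of [eps] pays for the distance from the error to a partial sum of its
   expansion, half for the norm of that partial sum; the bound [Hn] is uniform
   in the length [N], so [N] may depend on [n]. *)
rewrite normr_id of_realV normfV (gtr0_norm th0).
set eta := eps / 2 / of_real (theta n).
have eta0 : 0 < eta by rewrite divr_gt0.
have [N _ /(_ N (leqnn N)) HN] := (cvgrPdist_lt _ _).1 exp_n _ eta0.
have -> : eps / of_real (theta n) = eta + eta.
  by rewrite /eta -mulrDl -splitr.
rewrite -[X in `|X|](subrK (expansion I v (xdag - x n) N)).
apply: le_trans (ler_normD _ _) _; rewrite lerD //; first exact: ltW.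
rewrite -(@ler_pXn2r _ 2) ?nnegrE ?(ltW eta0) //.
rewrite (norm2_error_partial_sum hKst hsv halpha hr hx' N n xw).
rewrite exprMn exprVn ler_pdivlMr ?exprn_gt0 // mulr_suml.
apply: le_trans (Hn N); rewrite le_eqVlt; apply/orP; left; apply/eqP.
apply: eq_bigr => m _.
rewrite mulrAC [of_real _ ^+ 2]expr2 -!of_realM -expr2 -exprMn.
by congr (of_real (_ ^+ 2) * _); rewrite mulrC mulrA.
Qed.
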